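(* Let $M$ be a pointed metric space and let $x,y\in M$, $x\neq y$. The following assertions are equivalent: (i) $\frac{\delta_x-\delta_y}{d(x,y)}$ is a strongly exposed point of $B_{\mathcal F(M)}$. (ii) There is $f\in \mathrm{Lip}_0(M)$ peaking at $(x,y)$. (iii) For every $\varepsilon>0$, $$\inf_{u\in M\setminus(\{x\}\cup B(y,\varepsilon))}\frac{(y,x)_u}{(u,y)_x}>0\quad\text{and}\quad \inf_{u\in M\setminus(\{y\}\cup B(x,\varepsilon))}\frac{(y,x)_u}{(u,x)_y}>0$$ (with the convention that $\frac{\alpha}{0}=+\infty$). (iv) The pair $(x,y)$ does not have the property (Z).
   Context: A pointed metric space is a metric space $(M,d)$ with a distinguished point $0\in M$. $B(x,r)$ is the closed ball of center $x$ and radius $r$. $\mathrm{Lip}_0(M)$ is the real Banach space of all Lipschitz functions $f\colon M\to\mathbb R$ with $f(0)=0$, normed by the Lipschitz constant $\|f\|_L$. The Lipschitz free space is $\mathcal F(M)=\overline{\mathrm{span}}\{\delta_x:x\in M\}\subset \mathrm{Lip}_0(M)^*$, where $\delta_x(f)=f(x)$; one has $\mathcal F(M)^*=\mathrm{Lip}_0(M)$ isometrically. $B_X$ and $S_X$ denote the closed unit ball and the unit sphere of a Banach space $X$. A point $x\in S_X$ is a strongly exposed point of $B_X$ if there is $f\in S_{X^*}$ such that every sequence $\{x_n\}$ in $B_X$ with $\lim_n f(x_n)=f(x)$ is norm convergent to $x$. A Lipschitz function $f\colon M\to\mathbb R$ is peaking at $(x,y)$ (where $x\ne y$) if $\frac{f(x)-f(y)}{d(x,y)}=1$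 and for every open subset $U$ of $M^2\setminus\{(z,z):z\in M\}$ containing $(x,y)$ and $(y,x)$ there exists $\delta>0$ such that $(z,t)\notin U$ (with $z\neq t$) implies $\frac{|f(z)-f(t)|}{d(z,t)}\leq 1-\delta$. For $x,y,z\in M$ the Gromov product of $x$ and $y$ at $z$ is $(x,y)_z:=\frac12(d(x,z)+d(y,z)-d(x,y))\ge 0$. A pair $(x,y)$ of points of $M$, $x\neq y$, has the property (Z) if for every $\varepsilon>0$ there is $z\in M\setminus\{x,y\}$ such that $(x,y)_z\leq\varepsilon\min\{d(x,z),d(y,z)\}$. Infima over the empty set are $+\infty$. *)

(* Defs.v *)
From HB Require Import structures.
From mathcomp Require Import all_boot all_order all_algebra.
From mathcomp Require Import all_classical all_reals all_analysis.

Set Implicit Arguments.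
Unset Strict Implicit.
Unset Printing Implicit Defensive.

Import Order.TTheory GRing.Theory Num.Theory.
Import numFieldNormedType.Exports.

Local Open Scope classical_set_scope.
Local Open Scope ring_scope.

Lemma sup_le_of (R : realType) (A : set R) (K : R) :
  0 <= K -> (forall a, A a -> a <= K) -> sup A <= K.
Proof.
move=> K0 AK; have [->|/set0P A0] := eqVneq A set0; first by rewrite sup0.
exact: ge_sup.
Qed.

Lemma sup_ge0_of (R : realType) (A : set R) :
  (forall a, A a -> 0 <= a) -> 0 <= sup A.
Proof.
move=> A0; have [hs|/sup_out ->//] := pselect (has_sup A).
have [[a Aa] _] := hs.
by apply: (le_trans (A0 _ Aa)); exact: (sup_upper_bound hs).
Qed.

Section lip0.
Context (R : realType) (M : metricType R).
Implicit Types (f g : M -> R) (o p q : M).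

Definition is_lipschitz f :=
  exists K : R, forall p q, `|f p - f q| <= K * mdist p q.

(* [sup set0 = 0] covers the one-point space. *)
Definition slopes f : set R :=
  [set r | exists p q, p != q /\ r = `|f p - f q| / mdist p q].

Definition lip_norm f : R := sup (slopes f).

Definition lip0_pred o : {pred (M -> R)} :=
  mem [set f | is_lipschitz f /\ f o = 0].

Record Lip0 o := MkLip0 { lip0_fun :> M -> R ; _ : lip0_fun \in lip0_pred o }.

HB.instance Definition _ o := [isSub for @lip0_fun o].
HB.instance Definition _ o := [Choice of Lip0 o by <:].

Lemma lip0_submod_closed o : submod_closed (lip0_pred o).
Proof.
split; first by apply/mem_set; split=> //; exists 0 => p q; rewrite subrr normr0 mul0r.
move=> a f g /set_mem[[K HK] f0] /set_mem[[L HL] g0]; apply/mem_set.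
have E p : (a *: f + g) p = a * f p + g p by [].
split; last by rewrite E f0 g0 mulr0 addr0.
exists (`|a| * K + L) => p q; rewrite !E opprD addrACA -mulrBr.
rewrite (le_trans (ler_normD _ _))// mulrDl lerD//.
by rewrite normrM -mulrA ler_wpM2l.
Qed.

HB.instance Definition _ o :=
  GRing.isSubmodClosed.Build R _ (lip0_pred o) (lip0_submod_closed o).
HB.instance Definition _ o := [SubChoice_isSubLmodule of Lip0 o by <:].

Lemma lip0_lipschitz o (f : Lip0 o) : is_lipschitz f.
Proof. by have /set_mem[] := valP f. Qed.

Lemma lip0_base o (f : Lip0 o) : f o = 0.
Proof. by have /set_mem[] := valP f. Qed.

Lemma lip_norm_ge0 f : 0 <= lip_norm f.
Proof.
by apply: sup_ge0_of => _ [p [q [_ ->]]]; rewrite divr_ge0// mdist_ge0.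
Qed.

Lemma lip_norm_le f (K : R) : 0 <= K ->
  (forall p q, `|f p - f q| <= K * mdist p q) -> lip_norm f <= K.
Proof.
move=> K0 HK; apply: sup_le_of => // _ [p [q [pq ->]]].
by rewrite ler_pdivrMr// mdist_gt0.
Qed.

Lemma lip_normP f p q : is_lipschitz f ->
  `|f p - f q| <= lip_norm f * mdist p q.
Proof.
move=> [K HK]; have [->|pq] := eqVneq p q; first by rewrite subrr normr0 mdistxx mulr0.
have d0 : 0 < mdist p q by rewrite mdist_gt0.
rewrite -ler_pdivrMr//; apply: ub_le_sup; last by exists p, q.
exists K => _ [p' [q' [pq' ->]]].
by rewrite ler_pdivrMr// mdist_gt0.
Qed.

Lemma lip0_normD o (f g : Lip0 o) :
  lip_norm (f + g : Lip0 o) <= lip_norm f + lip_norm g.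
Proof.
apply: lip_norm_le => [|p q]; first by rewrite addr_ge0// lip_norm_ge0.
have -> : (f + g : Lip0 o) p - (f + g : Lip0 o) q = (f p - f q) + (g p - g q).
  by rewrite /= addrACA opprD.
rewrite (le_trans (ler_normD _ _))// mulrDl lerD//.
  exact/lip_normP/lip0_lipschitz.
exact/lip_normP/lip0_lipschitz.
Qed.

Let lip0_normZ_le o a (f : Lip0 o) :
  lip_norm (a *: f : Lip0 o) <= `|a| * lip_norm f.
Proof.
apply: lip_norm_le => [|p q]; first by rewrite mulr_ge0// lip_norm_ge0.
have -> : (a *: f : Lip0 o) p - (a *: f : Lip0 o) q = a * (f p - f q).
  by rewrite mulrBr.
by rewrite normrM -mulrA ler_wpM2l//; exact/lip_normP/lip0_lipschitz.
Qed.

Lemma lip0_normZ o a (f : Lip0 o) :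
  lip_norm (a *: f : Lip0 o) = `|a| * lip_norm f.
Proof.
apply/eqP; rewrite eq_le lip0_normZ_le /=.
have [->|a0] := eqVneq a 0; first by rewrite normr0 mul0r lip_norm_ge0.
rewrite -ler_pdivlMl ?normr_gt0// -normfV.
by have := lip0_normZ_le a^-1 (a *: f); rewrite scalerA mulVf// scale1r.
Qed.

Lemma lip0_norm_eq0 o (f : Lip0 o) : lip_norm f = 0 -> f = 0.
Proof.
move=> f0; apply/val_inj/funext => p.
have := lip_normP p o (lip0_lipschitz f).
by rewrite f0 mul0r lip0_base subr0 normr_le0 => /eqP.
Qed.

HB.instance Definition _ o := @Lmodule_isNormed.Build R (Lip0 o)
  (fun f : Lip0 o => lip_norm f) (@lip0_normD o) (@lip0_normZ o) (@lip0_norm_eq0 o).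

End lip0.

Section dual.
Context (R : realType) (V : normedModType R).

Definition dual_pred : {pred (V -> R)} :=
  mem [set phi : V -> R | linear phi /\ continuous phi].

Record dual := MkDual { dual_fun :> V -> R ; _ : dual_fun \in dual_pred }.

HB.instance Definition _ := [isSub for dual_fun].
HB.instance Definition _ := [Choice of dual by <:].

Lemma dual_submod_closed : submod_closed dual_pred.
Proof.
split.
  apply/mem_set; split=> [a u v|]; first by rewrite /= scaler0 addr0.
  exact: cst_continuous.
move=> a f g /set_mem[lf cf] /set_mem[lg cg]; apply/mem_set; split.
  move=> b u v; have E w : (a *: f + g) w = a *: f w + g w by [].
  rewrite !E lf lg !scalerDr !scalerA (mulrC b a) -!addrA; congr (_ + _).
  by rewrite addrCA.
move=> v; apply: (@continuousD _ _ _ (a *: f) g) => //; last exact: cg.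
by apply: continuousZr; exact: cf.
Qed.

HB.instance Definition _ :=
  GRing.isSubmodClosed.Build R _ dual_pred dual_submod_closed.
HB.instance Definition _ := [SubChoice_isSubLmodule of dual by <:].

Lemma dual_linear (phi : dual) : linear phi.
Proof. by have /set_mem[] := valP phi. Qed.

Lemma dual_continuous (phi : dual) : continuous phi.
Proof. by have /set_mem[] := valP phi. Qed.

HB.instance Definition _ (phi : dual) :=
  GRing.isLinear.Build R V R _ phi (dual_linear phi).

Definition dual_norm (phi : V -> R) : R :=
  sup [set `|phi v| | v in [set v : V | `|v| <= 1]].

Lemma dual_bounded (phi : dual) : exists K : R, forall v, `|phi v| <= K * `|v|.
Proof.
have /linear_boundedP[K [_ HK]] : bounded_near (phi : {linear V -> R^o}) (nbhs (0 : V)).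
  by apply: continuous_linear_bounded; exact: dual_continuous.
by exists (K + 1); apply: HK; rewrite ltrDl ltr01.
Qed.

Lemma dual_norm_ge0 (phi : V -> R) : 0 <= dual_norm phi.
Proof. by apply: sup_ge0_of => _ [v _ <-]. Qed.

Lemma dual_norm_le (phi : V -> R) (K : R) : 0 <= K ->
  (forall v, `|phi v| <= K * `|v|) -> dual_norm phi <= K.
Proof.
move=> K0 HK; apply: sup_le_of => // _ [v /= v1 <-].
by rewrite (le_trans (HK v))// ler_piMr.
Qed.

Lemma dual_normP (phi : dual) v : `|phi v| <= dual_norm phi * `|v|.
Proof.
have [->|v0] := eqVneq v 0; first by rewrite linear0 !normr0 mulr0.
have nv : 0 < `|v| by rewrite normr_gt0.
rewrite -ler_pdivrMr// mulrC; apply: ub_le_sup.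
  have [K HK] := dual_bounded phi; exists `|K| => _ [w /= w1 <-].
  by rewrite (le_trans (HK w))// (le_trans (ler_wpM2r _ (ler_norm K)))// ler_piMr.
exists (`|v|^-1 *: v); first by rewrite /= normrZ normfV normr_id mulVf// gt_eqF.
by rewrite linearZ normrM normfV normr_id.
Qed.

Lemma dual_normD (phi psi : dual) :
  dual_norm (phi + psi : dual) <= dual_norm phi + dual_norm psi.
Proof.
apply: dual_norm_le => [|v]; first by rewrite addr_ge0// dual_norm_ge0.
by rewrite mulrDl (le_trans (ler_normD _ _))// lerD// dual_normP.
Qed.

Let dual_normZ_le a (phi : dual) :
  dual_norm (a *: phi : dual) <= `|a| * dual_norm phi.
Proof.
apply: dual_norm_le => [|v]; first by rewrite mulr_ge0// dual_norm_ge0.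
rewrite [(a *: phi : dual) v](_ : _ = a * phi v)//.
by rewrite normrM -mulrA ler_wpM2l// dual_normP.
Qed.

Lemma dual_normZ a (phi : dual) :
  dual_norm (a *: phi : dual) = `|a| * dual_norm phi.
Proof.
apply/eqP; rewrite eq_le dual_normZ_le /=.
have [->|a0] := eqVneq a 0; first by rewrite normr0 mul0r dual_norm_ge0.
rewrite -ler_pdivlMl ?normr_gt0// -normfV.
by have := dual_normZ_le a^-1 (a *: phi); rewrite scalerA mulVf// scale1r.
Qed.

Lemma dual_norm_eq0 (phi : dual) : dual_norm phi = 0 -> phi = 0.
Proof.
move=> f0; apply/val_inj/funext => v.
by have := dual_normP phi v; rewrite f0 mul0r normr_le0 => /eqP.
Qed.

HB.instance Definition _ := @Lmodule_isNormed.Build R dual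
  (fun phi : dual => dual_norm phi) dual_normD dual_normZ dual_norm_eq0.

End dual.

Section closed_span.
Context (R : realType) (V : normedModType R).

Definition lin_span (A : set V) : set V :=
  [set v | exists2 s : seq (R * V), (forall c, c \in s -> A c.2) &
           v = \sum_(c <- s) c.1 *: c.2].

Definition closed_span (A : set V) : {pred V} := mem (closure (lin_span A)).

Lemma lin_span_linear A a u v :
  lin_span A u -> lin_span A v -> lin_span A (a *: u + v).
Proof.
move=> [s sA ->] [t tA ->]; exists ([seq (a * c.1, c.2) | c <- s] ++ t).
  move=> c; rewrite mem_cat => /orP[/mapP[d ds ->]|]; [exact: (sA d)|exact: tA].
rewrite big_cat big_map scaler_sumr; congr (_ + _).
by apply: eq_bigr => c _; rewrite scalerA.
Qed.

Lemma closed_span_closed A : submod_closed (closed_span A).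
Proof.
split.
  by apply/mem_set; apply: subset_closure; exists [::] => //; rewrite big_nil.
move=> a u v /set_mem uA /set_mem vA; apply/mem_set => B nB.
have cont : continuous (fun p : V * V => a *: p.1 + p.2).
  move=> p; apply: cvgD; last exact: cvg_snd.
  by apply: cvgZr; exact: cvg_fst.
have [[U W] /= [nU nW] UW] := cont (u, v) B nB.
have [u' [Au' Uu']] := uA _ nU; have [v' [Av' Wv']] := vA _ nW.
by exists (a *: u' + v'); split; [exact: lin_span_linear|exact: (UW (u', v'))].
Qed.

HB.instance Definition _ A :=
  GRing.isSubmodClosed.Build R V (closed_span A) (closed_span_closed A).

End closed_span.

Section free_space.
Context (R : realType) (M : metricType R) (o : M).

Definition eval_at (p : M) (f : Lip0 o) : R := f p.

Lemma eval_at_linear p : linear (eval_at p).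
Proof. by []. Qed.

HB.instance Definition _ p :=
  GRing.isLinear.Build R (Lip0 o) R _ (eval_at p) (eval_at_linear p).

Lemma eval_at_continuous p : continuous (eval_at p).
Proof.
apply: (@bounded_linear_continuous _ _ R^o (eval_at p)).
apply/linear_boundedP; exists (mdist p o); split; first exact: num_real.
move=> K ltK f; have := lip_normP p o (lip0_lipschitz f).
rewrite lip0_base subr0 => /le_trans; apply.
by rewrite mulrC ler_wpM2r// ?lip_norm_ge0// ltW.
Qed.

Definition delta (p : M) : dual (Lip0 o) :=
  MkDual (mem_set (conj (@eval_at_linear p) (@eval_at_continuous p))).

Record FreeSpace := MkFree {
  free_val :> dual (Lip0 o) ;
  _ : free_val \in closed_span (range delta) }.

HB.instance Definition _ := [isSub for free_val].
HB.instance Definition _ := [Choice of FreeSpace by <:].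
HB.instance Definition _ := [SubChoice_isSubLmodule of FreeSpace by <:].

Lemma free_normD (m n : FreeSpace) :
  `|val (m + n)| <= `|val m| + `|val n|.
Proof. by rewrite raddfD ler_normD. Qed.

Lemma free_normZ a (m : FreeSpace) : `|val (a *: m)| = `|a| * `|val m|.
Proof. by rewrite linearZ normrZ. Qed.

Lemma free_norm_eq0 (m : FreeSpace) : `|val m| = 0 -> m = 0.
Proof. by move/normr0_eq0 => m0; apply: val_inj; rewrite m0 raddf0. Qed.

HB.instance Definition _ := @Lmodule_isNormed.Build R FreeSpace
  (fun m : FreeSpace => `|val m|) free_normD free_normZ free_norm_eq0.

Lemma delta_free p : delta p \in closed_span (range delta).
Proof.
apply/mem_set/subset_closure; exists [:: (1, delta p)].
  by move=> c; rewrite inE => /eqP ->; exists p.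
by rewrite big_seq1 scale1r.
Qed.

Definition free_delta (p : M) : FreeSpace := MkFree (delta_free p).

Definition molecule (x y : M) : FreeSpace :=
  (mdist x y)^-1 *: (free_delta x - free_delta y).

End free_space.

Definition strongly_exposed (R : realType) (X : normedModType R) (x : X) :=
  `|x| = 1 /\
  exists2 f : dual X, `|f| = 1 &
    forall u : nat -> X, (forall n, `|u n| <= 1) ->
      f (u n) @[n --> \oo] --> f x -> u n @[n --> \oo] --> x.

Section metric_notions.
Context (R : realType) (M : metricType R).
Implicit Types x y z t : M.

(* The diagonal is closed in [M * M], so the open subsets of its complement
   are the open sets of [M * M] contained in that complement. *)
Definition peaking (f : M -> R) x y :=
  (f x - f y) / mdist x y = 1 /\
  forall U : set (M * M), open U -> U `<=` ~` diagonal -> U (x, y) -> U (y, x) ->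
    exists2 delta : R, 0 < delta &
      forall z t, z != t -> ~ U (z, t) -> `|f z - f t| / mdist z t <= 1 - delta.

(* The product $(x,y)_z$: the base point is the last argument. *)
Definition gromov x y z : R := (mdist x z + mdist y z - mdist x y) / 2.

Definition propertyZ x y :=
  forall eps : R, 0 < eps -> exists z,
    [/\ z != x, z != y & gromov x y z <= eps * Num.min (mdist x z) (mdist y z)].

(* [closed_ball] is the closure of the open ball, which may be smaller. *)
Definition cball x (r : R) : set M := [set y | mdist x y <= r].

(* [x / 0] is [0] in [R], and [0 / 0] would be [0] in [\bar R]; here every
   ratio with denominator [0] is [+oo]. *)
Definition eratio (a b : R) : \bar R :=
  if b == 0 then +oo%E else (a / b)%:E.

End metric_notions.

(* Main.v *)
(* (i) => (ii).  A functional strongly exposing the molecule is, up to sign, a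
   1-Lipschitz function f of slope 1 at (x, y); pairs of slope almost 1 have
   molecules close to that of (x, y), and the bumps max (r - d(x, .), 0) and
   max (r - d(y, .), 0) show that such pairs are themselves close to (x, y).

   (ii) => (iii).  Insert u between f x and f y: the pair (x, u) stays away from
   (x, y), which improves the triangle inequality by a multiple of d(x, u).

   (iv) => (i).  If (Z) fails with constant 2s, a function equal to
   d(x, y) / 2 - (1 - s) d(x, .) near x and to its opposite near y, cut off at 0,
   peaks at (x, y).  For any peaking f the Lipschitz norm is Frechet
   differentiable at f with derivative the molecule, so by Smulyan's argument
   f strongly exposes it: if mu(f) is almost 1 for mu in the ball, then
   mu(f + a h) <= |f + a h| bounds mu(h) uniformly in h. *)

Require Import Defs.
From HB Require Import structures.
From mathcomp Require Import all_boot all_order all_algebra.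
From mathcomp Require Import all_classical all_reals all_analysis.
From mathcomp Require Import ring lra.

Set Implicit Arguments.
Unset Strict Implicit.
Unset Printing Implicit Defensive.

Import Order.TTheory GRing.Theory Num.Theory.
Import numFieldNormedType.Exports.

Local Open Scope classical_set_scope.
Local Open Scope ring_scope.

(** * Peaking in terms of balls *)

Definition close_pairs {R : realType} {M : metricType R} (x y : M) (r : R)
    (z t : M) : Prop :=
  mdist x z < r /\ mdist y t < r.

(* [peaking] with the neighbourhoods of (x, y) and (y, x) replaced by products
   of balls. *)
Definition metric_peaking {R : realType} {M : metricType R} (f : M -> R)
    (x y : M) : Prop :=
  f x - f y = mdist x y /\
  forall r : R, 0 < r -> exists2 delta : R, 0 < delta &
    forall z t, [\/ `|f z - f t| <= (1 - delta) * mdist z t,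
      close_pairs x y r z t | close_pairs y x r z t].

Lemma close_pairs_nbhs (R : realType) (M : metricType R) (x y : M) (r : R) :
  0 < r -> nbhs (x, y) [set p | close_pairs x y r p.1 p.2].
Proof.
move=> r0; exists (ball x r, ball y r); first by split; exact: nbhsx_ballx.
by move=> [z t] /= []; rewrite !ballEmdist.
Qed.

Lemma nbhs_close_pairs (R : realType) (M : metricType R) (x y : M)
    (U : set (M * M)) :
  nbhs (x, y) U ->
  exists2 r : R, 0 < r & forall z t, close_pairs x y r z t -> U (z, t).
Proof.
move=> [[A B] /= [/nbhs_ballP[a /= a0 aA] /nbhs_ballP[b /= b0 bB]] AB].
exists (Num.min a b); first by rewrite lt_min a0.
move=> z t [xz yt]; apply: AB; split => /=.
  by apply: aA; rewrite ballEmdist/= (lt_le_trans xz)// ge_min lexx.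
by apply: bB; rewrite ballEmdist/= (lt_le_trans yt)// ge_min lexx orbT.
Qed.

Lemma close_pairs_lt_min (R : realType) (M : metricType R) (x y : M) (r s : R)
    (z t : M) :
  close_pairs x y (Num.min r s) z t ->
  close_pairs x y r z t /\ close_pairs x y s z t.
Proof. by move=> []; rewrite !lt_min => /andP[? ?] /andP[? ?]; do 2!split. Qed.

Lemma peakingP (R : realType) (M : metricType R) (f : M -> R) (x y : M) :
  x != y -> peaking f x y <-> metric_peaking f x y.
Proof.
move=> xy; have d0 : 0 < mdist x y by rewrite mdist_gt0.
split=> -[fxy fP]; split.
- by move/(congr1 ( *%R^~ (mdist x y))): fxy; rewrite divfK ?gt_eqF// mul1r.
(* The cap at half of [mdist x y] keeps [E] off the diagonal: a point closer than that to both x and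
   y would violate the triangle inequality. *)
- move=> r r0; pose s := Num.min r (mdist x y / 2).
  have s0 : 0 < s by rewrite lt_min r0 divr_gt0.
  pose E : set (M * M) :=
    [set p | close_pairs x y s p.1 p.2 \/ close_pairs y x s p.1 p.2].
  have [|||delta delta0 fE] := fP (interior E) (@open_interior _ E).
  + move=> [z t] /interior_subset Ezt /diagonalP zt; subst t.
    case: Ezt => /= /close_pairs_lt_min[_ []];
      have := metric_triangle x z y; rewrite (metric_sym z y); lra.
  + by apply: filterS (close_pairs_nbhs x y s0) => p; left.
  + by apply: filterS (close_pairs_nbhs y x s0) => p; right.
  exists delta => // z t; have [->|zt] := eqVneq z t.
    by constructor 1; rewrite mdistxx subrr normr0 mulr0.
  have [[/close_pairs_lt_min[]|/close_pairs_lt_min[]]|nE] := pselect (E (z, t)).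
  + by constructor 2.
  + by constructor 3.
  constructor 1; rewrite -ler_pdivrMr ?mdist_gt0//; apply: fE => //.
  by move/interior_subset.
- by rewrite fxy divff// gt_eqF.
- move=> U oU _ Uxy Uyx.
  have [r r0 rU] := nbhs_close_pairs (open_nbhs_nbhs (conj oU Uxy)).
  have [s s0 sU] := nbhs_close_pairs (open_nbhs_nbhs (conj oU Uyx)).
  have [|delta delta0 fd] := fP (Num.min r s); first by rewrite lt_min r0.
  exists delta => // z t zt nU; rewrite ler_pdivrMr ?mdist_gt0//.
  by case: (fd z t) => // /close_pairs_lt_min[? ?]; case: nU; [exact: rU|exact: sU].
Qed.

Lemma metric_peaking_opp (R : realType) (M : metricType R) (f : M -> R)
    (x y : M) :
  metric_peaking f x y -> metric_peaking (fun p => - f p) y x.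
Proof.
move=> [fxy fP]; split; first by rewrite metric_sym -fxy; ring.
move=> r /fP[delta delta0 fd]; exists delta => // z t.
by rewrite -opprD normrN; case: (fd z t) => ?; [constructor 1|constructor 3|constructor 2].
Qed.

(** Any pair other than (x, y) and (y, x) is left out by small enough balls, so the bound with 1 -
    delta applies to it. *)
Lemma metric_peaking_nonexpansive (R : realType) (M : metricType R)
    (f : M -> R) (x y z t : M) :
  metric_peaking f x y -> `|f z - f t| <= mdist z t.
Proof.
move=> [fxy fP].
have [[<- <-]|nxy] := pselect (x = z /\ y = t).
  by rewrite -fxy ger0_norm// fxy mdist_ge0.
have [[<- <-]|nyx] := pselect (y = z /\ x = t).
  by rewrite distrC metric_sym -fxy ger0_norm// fxy mdist_ge0.
have max_gt0 (a b p q : M) :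
    ~ (a = p /\ b = q) -> 0 < Num.max (mdist a p) (mdist b q).
  move=> nab; rewrite lt_max !mdist_gt0; apply/orP.
  have [ap|] := eqVneq a p; last by left.
  by right; apply/eqP => bq; apply: nab.
(* Since [close_pairs] is strict, the smaller of the distances from (z, t) to (x, y) and (y, x) in
   the maximum metric excludes both alternatives. *)
pose r := Num.min (Num.max (mdist x z) (mdist y t))
                  (Num.max (mdist y z) (mdist x t)).
have [|delta delta0 fd] := fP r; first by rewrite lt_min !max_gt0.
case: (fd z t) => [fzt|/close_pairs_lt_min[[a b] _]|/close_pairs_lt_min[_ [a b]]].
- by rewrite (le_trans fzt)// ler_piMl ?mdist_ge0//; lra.
- by move: a b; rewrite !lt_max !ltxx/= orbF => a b; have := lt_trans a b; rewrite ltxx.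
- by move: a b; rewrite !lt_max !ltxx/= orbF => a b; have := lt_trans a b; rewrite ltxx.
Qed.

(** * Gromov products and property (Z) *)

Lemma gromovC (R : realType) (M : metricType R) (x y u : M) :
  gromov x y u = gromov y x u.
Proof. by rewrite /gromov (metric_sym x y) (addrC (mdist x u)). Qed.

Lemma gromov_ge0 (R : realType) (M : metricType R) (x y u : M) :
  0 <= gromov x y u.
Proof.
rewrite /gromov; have := metric_triangle x u y; rewrite (metric_sym u y); lra.
Qed.

Lemma gromovD (R : realType) (M : metricType R) (x y u : M) :
  gromov y x u + gromov u y x = mdist x u.
Proof. by rewrite /gromov (metric_sym u x) (metric_sym u y); field. Qed.

(** Adding f x - f u <= (1 - delta) d(x, u) and f u - f y <= d(u, y) gives d(x, y) on the left,
    whence delta d(x, u) <= 2 (y, x)_u. *)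
Lemma peaking_gromov_ge (R : realType) (M : metricType R) (f : M -> R)
    (x y : M) (eps : R) :
  metric_peaking f x y -> 0 < eps ->
  exists2 c : R, 0 < c &
    forall u, eps < mdist y u -> c * mdist x u <= gromov y x u.
Proof.
move=> fP eps0; have [<-|xy] := eqVneq x y.
  exists 1 => // u _; rewrite /gromov mdistxx; lra.
have d0 : 0 < mdist x y by rewrite mdist_gt0.
(* [eps] keeps (x, u) away from (x, y), and [mdist x y] keeps it away from (y, x). *)
have [|delta delta0 fd] := fP.2 (Num.min eps (mdist x y)); first by rewrite lt_min eps0.
exists (delta / 2) => [|u yu]; first by rewrite divr_gt0.
have := metric_peaking_nonexpansive u y fP; rewrite ler_norml => /andP[_ fuy].
have := fP.1; rewrite /gromov (metric_sym y x) (metric_sym y u).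
case: (fd x u) => [|[_ +]|[+ _]].
- by rewrite ler_norml => /andP[_ fxu] fxy; lra.
- by rewrite lt_min => /andP[+ _] _; lra.
- by rewrite lt_min (metric_sym y x) ltxx andbF.
Qed.

(** With a = (y, x)_u and b = (u, y)_x one has a + b = d(x, u). So a >= c b yields a >= c / (1 + c)
    (a + b), and a >= c (a + b) yields a >= c b. Where b = 0 the ratio is infinite and a = d(x,
    u). *)
Lemma ereal_inf_eratio_gt0 (R : realType) (M : metricType R) (x y : M)
    (A : set M) :
  (0 < ereal_inf [set eratio (gromov y x u) (gromov u y x) | u in A])%E <->
  exists2 c : R, 0 < c & forall u, A u -> c * mdist x u <= gromov y x u.
Proof.
split=> [|[c c0 cA]].
- set B := [set _ | _ in _] => B0.
  have [c c0 cB] : exists2 c : R, 0 < c & (c%:E <= ereal_inf B)%E.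
    case: (ereal_inf B) B0 => [b|_|//]; last by exists 1; rewrite ?leey.
    by rewrite lte_fin => b0; exists b.
  exists (c / (1 + c)) => [|u Au]; first by rewrite divr_gt0// addr_gt0.
  have : (c%:E <= eratio (gromov y x u) (gromov u y x))%E.
    by apply: (le_trans cB); apply: ereal_inf_lbound; exists u.
  have := gromovD x y u; have := gromov_ge0 y x u; have := gromov_ge0 u y x.
  rewrite /eratio; move: (gromov y x u) (gromov u y x) => a b b0 a0 <-.
  rewrite mulrAC ler_pdivrMr ?addr_gt0//.
  case: eqP => [->|/eqP bn]; first by rewrite addr0; nra.
  rewrite lee_fin ler_pdivlMr ?lt_neqAle 1?eq_sym ?bn//; nra.
- apply: (@lt_le_trans _ _ c%:E); first by rewrite lte_fin.
  apply: le_ereal_inf_tmp => _ [u /cA + <-].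
  have := gromovD x y u; have := gromov_ge0 y x u; have := gromov_ge0 u y x.
  rewrite /eratio; move: (gromov y x u) (gromov u y x) => a b b0 a0 <- cab.
  case: eqP => [_|/eqP bn]; first exact: leey.
  rewrite lee_fin ler_pdivlMr ?lt_neqAle 1?eq_sym ?bn//; nra.
Qed.

(** The single radius d(x, y) / 3 suffices: no u lies in both closed balls of this radius about x
    and y, so one of the two infima controls each u other than x and y. *)
Lemma gromov_ratios_uniform (R : realType) (M : metricType R) (x y : M) :
  x != y ->
  (forall eps : R, 0 < eps ->
     (0 < ereal_inf [set eratio (gromov y x u) (gromov u y x)
                    | u in ~` ([set x] `|` cball y eps)])%E /\
     (0 < ereal_inf [set eratio (gromov y x u) (gromov u x y)
                    | u in ~` ([set y] `|` cball x eps)])%E) ->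
  exists2 c : R, 0 < c &
    forall u, c * Num.min (mdist x u) (mdist y u) <= gromov x y u.
Proof.
move=> xy inf_gt0; have d0 : 0 < mdist x y by rewrite mdist_gt0.
have [|/ereal_inf_eratio_gt0[a a0 aP]] := inf_gt0 (mdist x y / 3).
  by rewrite divr_gt0.
(* The numerator is symmetric in x and y, so the second infimum is the first with x and y
   exchanged. *)
under eq_imagel do rewrite gromovC.
move=> /ereal_inf_eratio_gt0[b b0 bP].
exists (Num.min a b) => [|u]; first by rewrite lt_min a0.
have min_le_gromov (e p : R) : 0 <= p -> p \in [:: mdist x u; mdist y u] ->
    e \in [:: a; b] -> e * p <= gromov x y u ->
    Num.min a b * Num.min (mdist x u) (mdist y u) <= gromov x y u.
  move=> p0 pE eE; apply: le_trans; apply: ler_pM => //.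
  - by rewrite le_min !ltW.
  - by rewrite le_min !mdist_ge0.
  - by move: eE; rewrite !inE => /orP[]/eqP ->; rewrite ge_min lexx ?orbT.
  - by move: pE; rewrite !inE => /orP[]/eqP ->; rewrite ge_min lexx ?orbT.
have [->|ux] := eqVneq u x.
  by rewrite mdistxx (@min_l _ _ 0) ?mdist_ge0// mulr0 gromov_ge0.
have [->|uy] := eqVneq u y.
  by rewrite mdistxx (@min_r _ _ _ 0) ?mdist_ge0// mulr0 gromov_ge0.
have [yu|yu] := ltP (mdist x y / 3) (mdist y u).
  apply: (min_le_gromov a (mdist x u)); rewrite ?mdist_ge0 ?mem_head//.
  rewrite gromovC; apply: aP => -[/eqP|]; first by rewrite (negPf ux).
  by rewrite /cball/= leNgt yu.
apply: (min_le_gromov b (mdist y u)); rewrite ?mdist_ge0 ?inE ?eqxx ?orbT//.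
apply: bP => -[/eqP|]; first by rewrite (negPf uy).
rewrite /cball/=; have := metric_triangle x u y; rewrite (metric_sym u y); lra.
Qed.

Lemma gromov_ge_notZ (R : realType) (M : metricType R) (x y : M) (c : R) :
  0 < c ->
  (forall u, c * Num.min (mdist x u) (mdist y u) <= gromov x y u) ->
  ~ propertyZ x y.
Proof.
move=> c0 cP /(_ (c / 2)) [|z [zx zy]]; first by rewrite divr_gt0.
have : 0 < Num.min (mdist x z) (mdist y z).
  by rewrite lt_min !mdist_gt0 ![_ == z]eq_sym zx.
have := cP z; nra.
Qed.

Lemma notZ_gromov_ge (R : realType) (M : metricType R) (x y : M) :
  ~ propertyZ x y ->
  exists2 c : R, 0 < c &
    forall u, c * Num.min (mdist x u) (mdist y u) <= gromov x y u.
Proof.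
move=> nZ; have [c [c0 cP]] : exists c : R, 0 < c /\ ~ exists z,
    [/\ z != x, z != y & gromov x y z <= c * Num.min (mdist x z) (mdist y z)].
  by apply: contra_notP nZ => nc e e0; apply: contra_notP nc => ne; exists e.
exists c => // u; have [->|ux] := eqVneq u x.
  by rewrite mdistxx (@min_l _ _ 0) ?mdist_ge0// mulr0 gromov_ge0.
have [->|uy] := eqVneq u y.
  by rewrite mdistxx (@min_r _ _ _ 0) ?mdist_ge0// mulr0 gromov_ge0.
by rewrite leNgt; apply/negP => /ltW ?; apply: cP; exists u.
Qed.

(** * Construction of a peaking function *)

(* On the set closer to [x] (resp. [y]) the slopes are at most [1 - s]; only pairs
   separated by the bisector can have slope near 1. *)
Definition peak_fun {R : realType} {M : metricType R} (x y : M) (s : R) (p : M) : R :=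
  if mdist x p <= mdist y p then Num.max (mdist x y / 2 - (1 - s) * mdist x p) 0
  else - Num.max (mdist x y / 2 - (1 - s) * mdist y p) 0.

Lemma peak_fun_same_side (R : realType) (s a p q D : R) :
  s <= 1 -> `|p - q| <= D ->
  `|Num.max (a - (1 - s) * p) 0 - Num.max (a - (1 - s) * q) 0| <= (1 - s) * D.
Proof.
move=> s1; rewrite !ler_norml => /andP[pqD qpD].
have s0 : 0 <= 1 - s by lra.
have A := ler_wpM2l s0 pqD; have B := ler_wpM2l s0 qpD.
by case: (leP (a - (1 - s) * p) 0) => ?; case: (leP (a - (1 - s) * q) 0) => ?;
   apply/andP; split; lra.
Qed.

(** If neither maximum is 0, adding the Gromov bounds at z and t bounds their sum by d(z, t) - s
    (d(x, z) + d(y, t)). The subtracted term exceeds or equals delta d(z, t) once one of the two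
    distances reaches r. *)
Lemma peak_fun_opposite_sides (R : realType) (M : metricType R) (x y z t : M)
    (s r delta : R) :
  0 < s -> s <= 1 / 2 -> 0 < delta -> delta <= s ->
  delta * (3 * mdist x y) <= s * r ->
  (forall u, 2 * s * Num.min (mdist x u) (mdist y u) <= gromov x y u) ->
  mdist x z <= mdist y z -> mdist y t <= mdist x t ->
  let D := Num.max (mdist x y / 2 - (1 - s) * mdist x z) 0 +
           Num.max (mdist x y / 2 - (1 - s) * mdist y t) 0 in
  D <= (1 - delta) * mdist z t \/ close_pairs x y r z t.
Proof.
move=> s0 s1 de0 des der gs xzy ytx.
have := gs t; have := gs z; rewrite min_l // min_r //.
have := metric_triangle y t z; have := metric_triangle x z t.
have : mdist z t <= mdist x z + mdist x y + mdist y t.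
  rewrite (metric_sym x z) (le_trans (metric_triangle z y t))// lerD2r.
  exact: metric_triangle.
have := mdist_ge0 x z; have := mdist_ge0 y t; have := mdist_ge0 x y.
have := mdist_ge0 z t.
rewrite /gromov /close_pairs (metric_sym t z).
move: der xzy ytx.
move: (mdist z t) (mdist x z) (mdist x t) (mdist y z) (mdist y t) (mdist x y).
move=> D X V W Y d der XW YV D0 d0 Y0 X0 DXY tX tY gz gt /=.
have sD : (1 - s) * D <= (1 - delta) * D by rewrite ler_wpM2r// lerB.
have s01 : 0 <= 1 - s by lra.
case: (leP (d / 2 - (1 - s) * X) 0) => x0;
  case: (leP (d / 2 - (1 - s) * Y) 0) => y0.
- by left; rewrite addr0 mulr_ge0//; lra.
(* Here d / 2 <= (1 - s) X, so the surviving term is at most (1 - s) (X - Y) <= (1 - s) (W - Y) <=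
   (1 - s) D. *)
- left; apply: le_trans sD; rewrite add0r.
  apply: (@le_trans _ _ ((1 - s) * (W - Y))); last by rewrite ler_wpM2l//; lra.
  by have := ler_wpM2l s01 XW; lra.
- left; apply: le_trans sD; rewrite addr0.
  apply: (@le_trans _ _ ((1 - s) * (V - X))); last by rewrite ler_wpM2l//; lra.
  by have := ler_wpM2l s01 YV; lra.
(* As both terms are positive and s <= 1 / 2, both X and Y are at most d. Hence D <= 3 d, the origin
   of the factor 3 in the hypothesis on delta. *)
have Xd : X <= d by have : s * X <= 1 / 2 * X; [rewrite ler_wpM2r|lra].
have Yd : Y <= d by have : s * Y <= 1 / 2 * Y; [rewrite ler_wpM2r|lra].
have dD : delta * D <= delta * (3 * d) by rewrite ler_wpM2l ?(ltW de0)//; lra.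
have [Xr|Xr] := ltP X r; have [Yr|Yr] := ltP Y r; [by right|left..].
- have : s * r <= s * Y by rewrite ler_wpM2l// ltW.
  have : 0 <= s * X by rewrite mulr_ge0// ltW.
  by lra.
- have : s * r <= s * X by rewrite ler_wpM2l// ltW.
  have : 0 <= s * Y by rewrite mulr_ge0// ltW.
  by lra.
- have : s * r <= s * X by rewrite ler_wpM2l// ltW.
  have : 0 <= s * Y by rewrite mulr_ge0// ltW.
  by lra.
Qed.

Lemma dist_mdist_le (R : realType) (M : metricType R) (p z t : M) :
  `|mdist p z - mdist p t| <= mdist z t.
Proof.
have := metric_triangle p z t; have := metric_triangle p t z.
by rewrite ler_norml (metric_sym t z) => ? ?; apply/andP; split; lra.
Qed.

Lemma peak_fun_peaking (R : realType) (M : metricType R) (x y : M) (s : R) :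
  x != y -> 0 < s -> s <= 1 / 2 ->
  (forall u, 2 * s * Num.min (mdist x u) (mdist y u) <= gromov x y u) ->
  metric_peaking (peak_fun x y s) x y.
Proof.
move=> xy s0 s1 gs; have d0 : 0 < mdist x y by rewrite mdist_gt0.
split=> [|r r0].
  rewrite /peak_fun !mdistxx mdist_ge0 leNgt d0/= mulr0 subr0.
  by rewrite max_l ?divr_ge0 ?mdist_ge0//; field.
have sr0 : 0 < s * r / (3 * mdist x y) by rewrite divr_gt0 ?mulr_gt0.
(* The first bound serves pairs on one side of the bisector; the second ties delta to r for
   separated pairs. *)
pose delta := Num.min s (s * r / (3 * mdist x y)).
have de0 : 0 < delta by rewrite lt_min s0.
have des : delta <= s by rewrite ge_min lexx.
have der : delta * (3 * mdist x y) <= s * r.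
  by rewrite -ler_pdivlMr ?mulr_gt0// ge_min lexx orbT.
have same_side p (z t : M) : `|Num.max (mdist x y / 2 - (1 - s) * mdist p z) 0 -
    Num.max (mdist x y / 2 - (1 - s) * mdist p t) 0| <= (1 - delta) * mdist z t.
  apply: (@le_trans _ _ ((1 - s) * mdist z t)).
    by apply: peak_fun_same_side; [lra|exact: dist_mdist_le].
  by rewrite ler_wpM2r ?mdist_ge0// lerB.
have max0 (a b : R) : 0 <= Num.max a 0 + Num.max b 0.
  by rewrite addr_ge0// le_max lexx orbT.
exists delta => // z t; rewrite /peak_fun.
have [xz|/ltW yz] := leP (mdist x z); have [xt|/ltW yt] := leP (mdist x t).
- by constructor 1; exact: same_side.
- rewrite opprK ger0_norm//.
  have [|] := peak_fun_opposite_sides s0 s1 de0 des der gs xz yt.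
    by constructor 1.
  by constructor 2.
(* Now z is on the side of y and t on the side of x: the previous case for (t, z). *)
- rewrite -opprD normrN addrC ger0_norm// (metric_sym z t).
  have [|[xrt yrz]] := peak_fun_opposite_sides s0 s1 de0 des der gs xt yz.
    by constructor 1.
  by constructor 3.
- by constructor 1; rewrite -opprD normrN; exact: same_side.
Qed.

(** * Molecules and functionals on the free space *)

Lemma lip_norm_le1P (R : realType) (M : metricType R) (o : M) (h : Lip0 o)
    (z t : M) :
  lip_norm h <= 1 -> h z - h t <= mdist z t.
Proof.
move=> h1; apply: (le_trans (ler_norm _)).
apply: (le_trans (lip_normP z t (lip0_lipschitz h))).
by rewrite ler_piMl ?mdist_ge0.
Qed.

Lemma free_eval_le (R : realType) (M : metricType R) (o : M) (u : FreeSpace o)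
    (h : Lip0 o) :
  `|u| <= 1 -> `|val u h| <= lip_norm h.
Proof.
move=> u1; apply: (le_trans (dual_normP (val u) h)).
by rewrite ler_piMl ?lip_norm_ge0.
Qed.

(** The unit ball of [Lip0 o] is symmetric, so one-sided bounds suffice. *)
Lemma free_norm_le (R : realType) (M : metricType R) (o : M) (u : FreeSpace o)
    (e : R) :
  0 <= e -> (forall h : Lip0 o, lip_norm h <= 1 -> val u h <= e) -> `|u| <= e.
Proof.
move=> e0 ue; apply: sup_le_of => // _ [h /= h1 <-].
rewrite ler_norml ue// andbT lerNl -linearN ue//.
by rewrite -[lip_norm _]/(`|- h|) normrN.
Qed.

Lemma molecule_eval (R : realType) (M : metricType R) (o x y : M) (h : Lip0 o) :
  val (molecule o x y) h = (h x - h y) / mdist x y.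
Proof. by rewrite mulrC. Qed.

Lemma free_sub_eval (R : realType) (M : metricType R) (o : M)
    (u v : FreeSpace o) (h : Lip0 o) :
  val (u - v) h = val u h - val v h.
Proof. by []. Qed.

Lemma molecule_eval_bounds (R : realType) (M : metricType R) (o x y : M)
    (h : Lip0 o) :
  x != y -> lip_norm h <= 1 -> -1 <= val (molecule o x y) h <= 1.
Proof.
move=> xy h1; rewrite molecule_eval ler_pdivlMr ?ler_pdivrMr ?mdist_gt0//.
by rewrite mulN1r mul1r lip_norm_le1P// andbT lerNl opprB metric_sym lip_norm_le1P.
Qed.

Lemma molecule_norm_le1 (R : realType) (M : metricType R) (o x y : M) :
  x != y -> `|molecule o x y| <= 1.
Proof.
move=> xy; apply: free_norm_le => // h h1.
by have /andP[] := molecule_eval_bounds xy h1.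
Qed.

Lemma based_nonexpansive (R : realType) (M : metricType R) (o : M) (f : M -> R) :
  (forall z t, `|f z - f t| <= mdist z t) ->
  exists h : Lip0 o, lip_norm h <= 1 /\ forall z, h z = f z - f o.
Proof.
move=> f1; have sub z t : (f z - f o) - (f t - f o) = f z - f t by ring.
have hP : (fun p => f p - f o) \in lip0_pred o.
  by apply/mem_set; split; [exists 1 => z t; rewrite sub mul1r|rewrite subrr].
exists (MkLip0 hP); split=> //; apply: lip_norm_le => // z t.
by rewrite /= sub mul1r.
Qed.

Definition free_eval {R : realType} {M : metricType R} {o : M} (f : Lip0 o)
    (u : FreeSpace o) : R := val u f.

Lemma free_eval_linear (R : realType) (M : metricType R) (o : M) (f : Lip0 o) :
  linear (free_eval f).
Proof. by []. Qed.

HB.instance Definition _ (R : realType) (M : metricType R) (o : M) (f : Lip0 o) :=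
  GRing.isLinear.Build R (FreeSpace o) R _ (free_eval f) (free_eval_linear f).

Lemma free_eval_continuous (R : realType) (M : metricType R) (o : M)
    (f : Lip0 o) :
  continuous (free_eval f).
Proof.
apply: (@bounded_linear_continuous _ _ R^o (free_eval f)).
apply/linear_boundedP; exists (lip_norm f); split; first exact: num_real.
move=> K fK u; apply: (le_trans (dual_normP (val u) f)).
by rewrite mulrC ler_wpM2r ?dual_norm_ge0// ltW.
Qed.

(** The functional represented by f under the duality F(M)^* = Lip_0(M). *)
Definition free_eval_dual {R : realType} {M : metricType R} {o : M}
    (f : Lip0 o) : dual (FreeSpace o) :=
  MkDual (mem_set (conj (free_eval_linear f) (@free_eval_continuous R M o f))).

(** The bump at x is r at x and 0 at y, so the molecule of (x, y) sends it to r / d(x, y). If d(x,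
    z) >= r, it vanishes at z and the molecule of (z, t) sends it to a nonpositive number, so the
    molecules are too far apart. The bump at y treats t, with signs reversed. *)
Lemma molecule_close (R : realType) (M : metricType R) (o x y z t : M) (r : R) :
  x != y -> z != t -> r <= mdist x y ->
  `|molecule o z t - molecule o x y| < r / mdist x y -> close_pairs x y r z t.
Proof.
move=> xy zt rd near_m.
have d0 : 0 < mdist x y by rewrite mdist_gt0.
have r0 : 0 < r.
  by move: (le_lt_trans (normr_ge0 _) near_m); rewrite pmulr_lgt0// invr_gt0.
have bump (p a b : M) : `|Num.max (r - mdist p a) 0 - Num.max (r - mdist p b) 0| <= mdist a b.
  apply: le_trans (dist_mdist_le p a b).
  rewrite ler_norml.
  case: (leP (r - mdist p a) 0) => ?; case: (leP (r - mdist p b) 0) => ?;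
    case: (ler0P (mdist p a - mdist p b)) => ?; apply/andP; split; lra.
have test (h : Lip0 o) : lip_norm h <= 1 ->
    `|(h z - h t) / mdist z t - (h x - h y) / mdist x y| < r / mdist x y.
  move=> h1; rewrite -!molecule_eval -free_sub_eval.
  apply: le_lt_trans near_m.
  apply: (le_trans (dual_normP (val (molecule o z t - molecule o x y)) h)).
  by apply: ler_piMr => //; exact: dual_norm_ge0.
have bump_center p : Num.max (r - mdist p p) 0 = r.
  by rewrite mdistxx subr0 max_l// ltW.
have bump_far (p a : M) : r <= mdist p a -> Num.max (r - mdist p a) 0 = 0.
  by move=> ra; rewrite max_r// subr_le0.
split; rewrite ltNge; apply/negP => far.
- have [h [h1 hE]] := based_nonexpansive o (bump x).
  have := test h h1.
  have -> : h x - h y = r by rewrite !hE bump_center (bump_far x y)//; ring.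
  rewrite ltNge => /negP; apply; rewrite distrC (le_trans _ (ler_norm _))//.
  rewrite lerDl oppr_ge0 pmulr_lle0 ?invr_gt0 ?mdist_gt0// !hE (bump_far x z)//.
  have : 0 <= Num.max (r - mdist x t) 0 by rewrite le_max lexx orbT.
  lra.
- have [h [h1 hE]] := based_nonexpansive o (bump y).
  have := test h h1.
  have -> : h x - h y = - r.
    by rewrite !hE bump_center (bump_far y x) ?[mdist y x]metric_sym//; ring.
  rewrite ltNge => /negP; apply; rewrite (le_trans _ (ler_norm _))//.
  rewrite mulNr opprK lerDr pmulr_lge0 ?invr_gt0 ?mdist_gt0// !hE (bump_far y t)//.
  have : 0 <= Num.max (r - mdist y z) 0 by rewrite le_max lexx orbT.
  lra.
Qed.

(** Moving the endpoints costs at most d(x, z) + d(y, t), and replacing d(x, y) by d(z, t) costs as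
    much again because the molecule is at most 1 in absolute value at h. The total is below e d(x,
    y) / 2, which is at most e d(z, t). *)
Lemma slope_near (R : realType) (M : metricType R) (o x y z t : M) (e : R)
    (h : Lip0 o) :
  x != y -> 0 < e -> e <= 1 -> lip_norm h <= 1 ->
  close_pairs x y (e * mdist x y / 8) z t ->
  h z - h t <= (val (molecule o x y) h + e) * mdist z t.
Proof.
move=> xy e0 e1 h1 [xz yt]; have d0 : 0 < mdist x y by rewrite mdist_gt0.
have /andP[] := molecule_eval_bounds xy h1; set m := val (molecule o x y) h => m_geN1 m_le1.
have mE : h x - h y = m * mdist x y by rewrite /m molecule_eval divfK// gt_eqF.
have hd := lip_norm_le1P _ _ h1.
have := hd z x; have := hd y t; rewrite (metric_sym z x).
have := metric_triangle x z t; have := metric_triangle z x t.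
have := metric_triangle x t y; have := metric_triangle x y t.
rewrite (metric_sym z x) (metric_sym t y).
move: (mdist x t) (mdist z t) (mdist x z) (mdist y t) (mdist x y) mE xz yt d0.
move=> V D X Y d mE Xe Ye d0 xyt xty zxt xzt hyt hzx.
have mdD : m * (d - D) <= X + Y.
  have [dD|dD] := lerP 0 (d - D).
    by apply: (@le_trans _ _ (d - D)); [rewrite ler_piMl|lra].
  have : 0 <= (m + 1) * (D - d) by rewrite mulr_ge0//; lra.
  by lra.
have ed : e * d <= d by rewrite ler_piMl// ltW.
have : e * (d / 2) <= e * D by rewrite ler_wpM2l ?(ltW e0)//; lra.
lra.
Qed.

(** * From peaking to strong exposure *)

(* Quantitative Frechet differentiability of the Lipschitz norm at a peaking
   function, with derivative the molecule. *)
Lemma peaking_norm_perturb (R : realType) (M : metricType R) (o x y : M) (e : R)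
    (f : Lip0 o) :
  x != y -> metric_peaking f x y -> 0 < e -> e <= 1 ->
  exists2 a : R, 0 < a & forall h : Lip0 o, lip_norm h <= 1 ->
    lip_norm (f + a *: h) <= 1 + a * (val (molecule o x y) h + e).
Proof.
move=> xy fP e0 e1; have d0 : 0 < mdist x y by rewrite mdist_gt0.
have [|delta delta0 fd] := fP.2 (e * mdist x y / 8).
  by rewrite divr_gt0// mulr_gt0.
(* [delta / 2] serves pairs where f has slope at most 1 - delta, as 1 - delta + a <= 1 - a. [1 / 2]
   serves pairs near (y, x), where f z - f t is negative and a <= 1 - a is enough. *)
exists (Num.min (delta / 2) (1 / 2)); first by rewrite lt_min !divr_gt0.
set a := Num.min _ _; have a0 : 0 < a by rewrite lt_min !divr_gt0.
have ad : a <= delta / 2 by rewrite ge_min lexx.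
have a2 : a <= 1 / 2 by rewrite ge_min lexx orbT.
move=> h h1; have /andP[mN m1] := molecule_eval_bounds xy h1.
set m := val (molecule o x y) h in mN m1 *; set K := 1 + _.
(* This holds for every h in the ball because m >= -1. *)
have aK : 1 - a <= K.
  have : 0 <= a * (m + e + 1) by rewrite mulr_ge0 ?(ltW a0)//; lra.
  by rewrite /K; lra.
have slope z t : (f z - f t) + a * (h z - h t) <= K * mdist z t.
  have hzt := lip_norm_le1P z t h1; have D0 := mdist_ge0 z t.
  have ahzt : a * (h z - h t) <= a * mdist z t by rewrite ler_wpM2l// ltW.
  have KD : (1 - a) * mdist z t <= K * mdist z t by rewrite ler_wpM2r.
  have aD : 0 <= (1 / 2 - a) * mdist z t by rewrite mulr_ge0//; lra.
  case: (fd z t) => [fzt|near_xy|[yz xt]].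
  - have : 0 <= (delta / 2 - a) * mdist z t by rewrite mulr_ge0//; lra.
    have := le_trans (ler_norm _) fzt; lra.
  - have := metric_peaking_nonexpansive z t fP; rewrite ler_norml => /andP[_ fzt].
    have := slope_near xy e0 e1 h1 near_xy; rewrite -/m => hm.
    have : a * (h z - h t) <= a * ((m + e) * mdist z t) by rewrite ler_wpM2l// ltW.
    by rewrite /K; lra.
  - have := metric_peaking_nonexpansive z y fP; rewrite ler_norml => /andP[_ fzy].
    have := metric_peaking_nonexpansive x t fP; rewrite ler_norml => /andP[_ fxt].
    have ed : e * mdist x y <= mdist x y by rewrite ler_piMl// ltW.
    by move: fP.1 fzy fxt; rewrite (metric_sym z y); lra.
apply: lip_norm_le => [|z t]; first by lra.
have sE p q : (f + a *: h) p - (f + a *: h) q = (f p - f q) + a * (h p - h q).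
  by rewrite mulrBr opprD addrACA.
rewrite ler_norml sE slope andbT lerNl.
by have := slope t z; rewrite (metric_sym t z); lra.
Qed.

Lemma peaking_strongly_exposed (R : realType) (M : metricType R) (o x y : M)
    (f : Lip0 o) :
  x != y -> metric_peaking f x y -> strongly_exposed (molecule o x y).
Proof.
move=> xy fP; have d0 : 0 < mdist x y by rewrite mdist_gt0.
have f1 : lip_norm f <= 1.
  by apply: lip_norm_le => // z t; rewrite mul1r; exact: metric_peaking_nonexpansive fP.
have mf : val (molecule o x y) f = 1 by rewrite molecule_eval fP.1 divff// gt_eqF.
have m1 : `|molecule o x y| = 1.
  apply/eqP; rewrite eq_le molecule_norm_le1//=.
  have := dual_normP (val (molecule o x y)) f; rewrite mf normr1 => /le_trans; apply.
  by apply: ler_piMr => //; exact: dual_norm_ge0.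
split=> //; exists (free_eval_dual f).
  apply/eqP; rewrite eq_le; apply/andP; split.
    apply: dual_norm_le => // u; rewrite mul1r.
    apply: (le_trans (dual_normP (val u) f)).
    by apply: ler_piMr => //; exact: dual_norm_ge0.
  have := dual_normP (free_eval_dual f) (molecule o x y).
  by rewrite m1 mulr1 [free_eval_dual f _]mf normr1.
move=> u u1; rewrite [free_eval_dual f (molecule o x y)]mf => uf.
(* Two errors e' will add up, one from the norm of f + a h and one from the gap 1 - u_n(f) <= a e'.
   The cap 1 is for [peaking_norm_perturb]. *)
apply/cvgrPdist_le => e e0; pose e' := Num.min (e / 2) 1.
have e'0 : 0 < e' by rewrite lt_min divr_gt0 ?ltr01.
have e'1 : e' <= 1 by rewrite ge_min lexx orbT.
have e'e : e' <= e / 2 by rewrite ge_min lexx.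
have [a a0 fa] := peaking_norm_perturb xy fP e'0 e'1.
move/cvgrPdist_le: uf => /(_ (a * e')) [|N _ uN]; first exact: mulr_gt0.
exists N => // n /uN /= fun1; rewrite distrC.
apply: free_norm_le => [|h h1]; first exact: ltW.
have := le_trans (ler_norm _) (free_eval_le (f + a *: h) (u1 n)).
rewrite [val (u n) _](_ : _ = val (u n) f + a * val (u n) h); last first.
  by rewrite linearD linearZ.
move=> /le_trans/(_ (fa h h1)) uh.
have uf1 : 1 - val (u n) f <= a * e' := le_trans (ler_norm _) fun1.
rewrite free_sub_eval; set m := val (molecule o x y) h in uh *.
have : a * (val (u n) h - m) <= a * (2 * e') by lra.
by rewrite ler_pM2l//; lra.
Qed.

(** * From strong exposure to peaking *)

(** [strongly_exposed] does not ask the functional to be 1 at the exposed point; this recovers it up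
    to sign. If |F m| < 1, some v in the ball has |F v| > |F m|, and v scaled by F m / F v has norm
    below 1 and the same value as m, hence equals m, a contradiction. *)
Lemma dual_norm_attained_level (R : realType) (X : normedModType R) (F : dual X)
    (m : X) :
  `|F| = 1 -> `|m| = 1 -> (forall v, `|v| <= 1 -> F v = F m -> v = m) ->
  `|F m| = 1.
Proof.
move=> F1 m1 Fm; apply/eqP; rewrite eq_le; apply/andP; split.
  by rewrite (le_trans (dual_normP F m))// m1 mulr1 -[dual_norm F]/(`|F|) F1.
rewrite leNgt; apply/negP => Fm1.
have [v v1 Fv] : exists2 v, `|v| <= 1 & `|F m| < `|F v|.
  apply: contrapT => nv; move: F1; apply/eqP; rewrite lt_eqF//.
  apply: le_lt_trans Fm1; apply: sup_le_of => // _ [v /= v1 <-].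
  by rewrite leNgt; apply/negP => Fv; apply: nv; exists v.
have Fv0 : 0 < `|F v| by apply: le_lt_trans Fv.
have : (F m / F v) *: v = m.
  apply: Fm; last by rewrite linearZ; apply: divfK; rewrite -normr_gt0.
  by rewrite normrZ normf_div mulr_ile1 ?divr_ge0// ler_pdivrMr// mul1r ltW.
move/(congr1 Num.norm); rewrite m1 normrZ normf_div => E.
suff : `|F m| / `|F v| * `|v| < 1 by rewrite E ltxx.
apply: (@le_lt_trans _ _ (`|F m| / `|F v|)); first by rewrite ler_piMr ?divr_ge0.
by rewrite ltr_pdivrMr// mul1r.
Qed.

(** Counterexamples for eta = 1 / (n + 1) would form a sequence in the ball with F (u n) tending to
    F m but staying at distance at least e from m. *)
Lemma exposing_modulus (R : realType) (X : normedModType R) (F : dual X) (m : X)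
    (e : R) :
  (forall u : nat -> X, (forall n, `|u n| <= 1) ->
     F (u n) @[n --> \oo] --> F m -> u n @[n --> \oo] --> m) ->
  0 < e ->
  exists2 eta : R, 0 < eta &
    forall v, `|v| <= 1 -> `|F v - F m| <= eta -> `|v - m| < e.
Proof.
move=> Fm e0; apply: contrapT => nF.
have /choice[u uP] : forall n : nat, exists v : X,
    [/\ `|v| <= 1, `|F v - F m| <= n.+1%:R^-1 & e <= `|v - m|].
  move=> n; apply: contrapT => nv; apply: nF; exists n.+1%:R^-1 => // v v1 Fv.
  by rewrite ltNge; apply/negP => ev; apply: nv; exists v.
have Fu : F (u n) @[n --> \oo] --> F m.
  apply/cvgrPdist_le => d d0; near=> n.
  have [_ un _] := uP n; rewrite distrC (le_trans un)//.
  by near: n; have := near_infty_natSinv_lt (PosNum d0); apply: filterS => n /ltW.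
have /cvgrPdist_lt/(_ e e0)[N _ /(_ N (leqnn N))/=] :=
  Fm u (fun n => let: And3 un _ _ := uP n in un) Fu.
by have [_ _] := uP N; rewrite distrC leNgt => /negP.
Unshelve. all: by end_near.
Qed.

(** F is pulled back along [free_delta]; the result is nonexpansive because molecules lie in the
    unit ball. The sign s will correct the case F m = -1. *)
Lemma delta_eval_lipschitz (R : realType) (M : metricType R) (o : M)
    (F : dual (FreeSpace o)) (s : R) :
  `|F| = 1 -> `|s| = 1 ->
  exists h : Lip0 o, forall z t,
    (h z - h t) / mdist z t = s * F (molecule o z t).
Proof.
move=> F1 s1; pose g z := s * F (free_delta o z).
have gE z t : (g z - g t) / mdist z t = s * F (molecule o z t).
  have -> : F (molecule o z t) =
      (F (free_delta o z) - F (free_delta o t)) / mdist z t.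
    by rewrite linearZ linearB; exact: mulrC.
  by rewrite /g -mulrBr mulrA.
have g1 z t : `|g z - g t| <= mdist z t.
  have [->|zt] := eqVneq z t; first by rewrite subrr normr0 mdistxx.
  have d0 : 0 < mdist z t by rewrite mdist_gt0.
  rewrite -[leLHS](divfK (lt0r_neq0 d0)) ler_piMl ?mdist_ge0//.
  rewrite -(gtr0_norm d0) -normf_div gE normrM s1 mul1r.
  rewrite (le_trans (dual_normP F _))// -[dual_norm F]/(`|F|) F1 mul1r.
  exact: molecule_norm_le1.
have [h [_ hE]] := based_nonexpansive o g1.
by exists h => z t; rewrite !hE -gE; congr (_ / _); ring.
Qed.

Lemma strongly_exposed_peaking (R : realType) (M : metricType R) (o x y : M) :
  x != y -> strongly_exposed (molecule o x y) ->
  exists f : Lip0 o, metric_peaking f x y.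
Proof.
move=> xy [m1 [F F1 FP]]; set m := molecule o x y in m1 FP *.
have d0 : 0 < mdist x y by rewrite mdist_gt0.
have Fm1 : `|F m| = 1.
  apply: dual_norm_attained_level => // v v1 Fv.
  (* The constant sequence v must converge to m. *)
  have : (v @[n --> \oo]) --> m.
    by apply: (FP (fun=> v)) => //; rewrite Fv; exact: cvg_cst.
  by move=> /(cvg_lim (@norm_hausdorff _ _)) <-; rewrite (lim_cst (@norm_hausdorff _ _)).
have Fm2 : F m * F m = 1 by rewrite -expr2 -real_normK ?num_real// Fm1 expr1n.
(* With s = F m, the slope of f at (x, y) is the square of F m, which is 1. *)
have [f fE] := delta_eval_lipschitz F1 Fm1.
exists f; split.
  by rewrite -[LHS](divfK (lt0r_neq0 d0)) fE Fm2 mul1r.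
move=> r r0; pose r' := Num.min r (mdist x y).
have r'0 : 0 < r' by rewrite lt_min r0.
have r'd : r' <= mdist x y by rewrite ge_min lexx orbT.
have [|eta eta0 etaP] := exposing_modulus FP (e := r' / mdist x y).
  by rewrite divr_gt0.
have steep z t : (1 - eta) * mdist z t < f z - f t -> close_pairs x y r z t.
  have [->|zt] := eqVneq z t; first by rewrite mdistxx mulr0 subrr ltxx.
  rewrite -ltr_pdivlMr ?mdist_gt0// fE => Fzt.
  have zt1 := molecule_norm_le1 o zt.
  suff : `|molecule o z t - m| < r' / mdist x y.
    by move=> /(molecule_close xy zt r'd) /close_pairs_lt_min[].
  apply: etaP => //.
  have -> : F (molecule o z t) - F m = F m * (F m * F (molecule o z t) - 1).
    by rewrite mulrBr mulrA Fm2; ring.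
  rewrite normrM Fm1 mul1r.
  have : `|F m * F (molecule o z t)| <= 1.
    rewrite normrM Fm1 mul1r (le_trans (dual_normP F _))//.
    by rewrite -[dual_norm F]/(`|F|) F1 mul1r.
  by rewrite !ler_norml => /andP[? ?]; apply/andP; split; lra.
exists eta => // z t.
have [zt|zt] := leP (f z - f t) ((1 - eta) * mdist z t); last first.
  by constructor 2; exact: steep.
have [tz|tz] := leP (f t - f z) ((1 - eta) * mdist z t).
  by constructor 1; rewrite ler_norml zt andbT lerNl opprB.
(* That (t, z) is near (x, y) means that (z, t) is near (y, x). *)
by constructor 3; have [|xt yz] := steep t z; first by rewrite (metric_sym t z).
Qed.

(** * The cycle of implications *)

Theorem theorem4p4 (R : realType) (M : metricType R) (o x y : M) (xy : x != y) :
  [<-> strongly_exposed (molecule o x y);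
       exists f : Lip0 o, peaking f x y;
       forall eps : R, 0 < eps ->
         (0 < ereal_inf [set eratio (gromov y x u) (gromov u y x)
                        | u in ~` ([set x] `|` cball y eps)])%E /\
         (0 < ereal_inf [set eratio (gromov y x u) (gromov u x y)
                        | u in ~` ([set y] `|` cball x eps)])%E;
       ~ propertyZ x y].
Proof.
split; last split; last split.
- move=> /(strongly_exposed_peaking xy)[f fP]; exists f.
  exact/(peakingP f xy).
- move=> [f /(peakingP f xy) fP] eps eps0.
  split.
    apply/ereal_inf_eratio_gt0.
    have [c c0 cP] := peaking_gromov_ge fP eps0; exists c => // u uA; apply: cP.
    by rewrite ltNge; apply/negP => yu; apply: uA; right.
  (* By symmetry this is the first infimum for -f, which peaks at (y, x). *)
  under eq_imagel do rewrite gromovC.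
  apply/ereal_inf_eratio_gt0.
  have [c c0 cP] := peaking_gromov_ge (metric_peaking_opp fP) eps0.
  exists c => // u uA; apply: cP.
  by rewrite ltNge; apply/negP => xu; apply: uA; right.
- move=> /(gromov_ratios_uniform xy)[c c0 cP]; exact: gromov_ge_notZ cP.
- move=> /notZ_gromov_ge[c c0 cP].
  (* [peak_fun_peaking] takes the Gromov bound with constant 2 s and needs s <= 1 / 2. *)
  pose s := Num.min (c / 2) (1 / 2).
  have s0 : 0 < s by rewrite lt_min !divr_gt0.
  have sc : 2 * s <= c by have : s <= c / 2; [rewrite ge_min lexx|lra].
  have s1 : s <= 1 / 2 by rewrite ge_min lexx orbT.
  have sP u : 2 * s * Num.min (mdist x u) (mdist y u) <= gromov x y u.
    by apply: le_trans (cP u); rewrite ler_wpM2r// le_min !mdist_ge0.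
  have fP := peak_fun_peaking xy s0 s1 sP.
  (* Subtracting the value at o gives an element of [Lip0 o] with the same differences. *)
  have [h [_ hE]] := based_nonexpansive o
    (fun z t => metric_peaking_nonexpansive z t fP).
  have hsub z t : h z - h t = peak_fun x y s z - peak_fun x y s t.
    by rewrite !hE; ring.
  apply: (peaking_strongly_exposed (f := h) xy); split; first by rewrite hsub fP.1.
  move=> r /(fP.2 r)[delta delta0 fd]; exists delta => // z t.
  by rewrite hsub; exact: fd.
Qed.
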